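(* Let $K\subset\mathbb R^3$ be a nondegenerate tetrahedron with vertices $\boldsymbol x_1,\dots,\boldsymbol x_4$, and let $l\in\{1,2,3,4\}$. For $i=1,2$ define $$\boldsymbol\varphi_{F_l,i}:=\tfrac14(8\lambda_l-3)(\boldsymbol x-\boldsymbol x_K)\times(\boldsymbol n_l\times\nabla\lambda_{l_i})+\tfrac14\big((\boldsymbol x_l-\boldsymbol x_K)\cdot\boldsymbol n_l\big)\nabla\lambda_{l_i}+\tfrac1{16}\boldsymbol n_l .$$ Then $\boldsymbol\varphi_{F_l,1}$ and $\boldsymbol\varphi_{F_l,2}$ are the basis functions of $\boldsymbol W_0(K)$ being dual to $M_{F_l,1}$ and $M_{F_l,2}$, respectively. That is, $$M_e(\boldsymbol\varphi_{F_l,1})=M_e(\boldsymbol\varphi_{F_l,2})=0\quad\forall\, e\in\mathcal E(K),$$ $$\boldsymbol M_F(\boldsymbol\varphi_{F_l,1})=\boldsymbol M_F(\boldsymbol\varphi_{F_l,2})=\boldsymbol 0\quad\forall\, F\in\mathcal F(K)\setminus\{F_l\},$$ $$M_{F_l,2}(\boldsymbol\varphi_{F_l,1})=M_{F_l,1}(\boldsymbol\varphi_{F_l,2})=0,\qquad M_{F_l,1}(\boldsymbol\varphi_{F_l,1})=M_{F_l,2}(\boldsymbol\varphi_{F_l,2})=1.$$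
   Context: $\boldsymbol x_K$ is the barycenter of $K$; $\mathcal E(K)$, $\mathcal F(K)$ are the sets of edges and faces of $K$; $\mathbb P_m(K)$ denotes polynomials of total degree at most $m$ and $\mathbb P_m(K;\mathbb R^3)$ the vector version. $\boldsymbol W_0(K):=\nabla\mathbb P_1(K)\oplus\big((\boldsymbol x-\boldsymbol x_K)\times\mathbb P_1(K;\mathbb R^3)\big)$, a space of dimension $14$. $\lambda_1,\dots,\lambda_4$ are the barycentric coordinates with respect to $\boldsymbol x_1,\dots,\boldsymbol x_4$. $F_l$ is the face of $K$ opposite to $\boldsymbol x_l$, with vertices $\boldsymbol x_{l_1},\boldsymbol x_{l_2},\boldsymbol x_{l_3}$, $l_1<l_2<l_3$; $\boldsymbol n_l$ is the unit outward normal to $\partial K$ on $F_l$; $|F_l|$ is its area. $e_{ij}$ is the edge with vertices $\boldsymbol x_i,\boldsymbol x_j$, and $\boldsymbol t_{ij}:=\boldsymbol x_j-\boldsymbol x_i$. The functionals are $$M_{e_{ij}}(\boldsymbol v):=\frac1{|e_{ij}|}\int_{e_{ij}}\boldsymbol v\cdot\boldsymbol t_{ij}\,\mathrm ds,\qquad \boldsymbol M_{F_l}(\boldsymbol v):=\int_{F_l}(\operatorname{curl}\boldsymbol v)\times\boldsymbol n_l\,\mathrm ds,$$ $$M_{F_l,1}(\boldsymbol v):=\frac{1}{2|F_l|(\nabla\lambda_{l_1}\times\nabla\lambda_{l_2})\cdot\boldsymbol n_l}\int_{F_l}(\operatorname{curl}\boldsymbol v)\cdot\big((\boldsymbol n_l\times\nabla\lambda_{l_2})\times\boldsymbol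 n_l\big)\,\mathrm ds,$$ $$M_{F_l,2}(\boldsymbol v):=\frac{1}{2|F_l|(\nabla\lambda_{l_2}\times\nabla\lambda_{l_1})\cdot\boldsymbol n_l}\int_{F_l}(\operatorname{curl}\boldsymbol v)\cdot\big((\boldsymbol n_l\times\nabla\lambda_{l_1})\times\boldsymbol n_l\big)\,\mathrm ds.$$ *)

(* Defs.v *)
From mathcomp Require Import all_boot all_order all_algebra.
From mathcomp Require Import all_classical all_reals all_analysis.

Set Implicit Arguments.
Unset Strict Implicit.
Unset Printing Implicit Defensive.

Import Order.TTheory GRing.Theory Num.Theory.
Import numFieldNormedType.Exports.

Local Open Scope classical_set_scope.
Local Open Scope ring_scope.

Section Vectors.
Variable R : realType.
Implicit Types (u v : 'rV[R]_3).

Definition vec3 (a b c : R) : 'rV[R]_3 := \row_(k < 3) [:: a; b; c]`_k.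

Definition dotp u v : R := \sum_(k < 3) u 0 k * v 0 k.

Definition crossp u v : 'rV[R]_3 :=
  vec3 (u 0 1 * v 0 2 - u 0 2 * v 0 1)
       (u 0 2 * v 0 0 - u 0 0 * v 0 2)
       (u 0 0 * v 0 1 - u 0 1 * v 0 0).

(* The Euclidean norm; the library's `|u| on 'rV[R]_3 is the sup norm. *)
Definition enorm u : R := Num.sqrt (dotp u u).

Definition partial (k : 'I_3) (f : 'rV[R]_3 -> R) (y : 'rV[R]_3) : R :=
  'D_(delta_mx 0 k) f y.

Definition grad (f : 'rV[R]_3 -> R) (y : 'rV[R]_3) : 'rV[R]_3 :=
  \row_k partial k f y.

Definition curl (v : 'rV[R]_3 -> 'rV[R]_3) (y : 'rV[R]_3) : 'rV[R]_3 :=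
  let d k j := partial k (fun z => v z 0 j) y in
  vec3 (d 1 2 - d 2 1) (d 2 0 - d 0 2) (d 0 1 - d 1 0).

(* Polynomial functions of total degree at most m.  A polynomial on a
   nondegenerate tetrahedron is identified with its unique polynomial extension
   to the whole space. *)
Definition is_poly (m : nat) (f : 'rV[R]_3 -> R) : Prop :=
  exists c : nat -> nat -> nat -> R, forall y,
    f y = \sum_(i < m.+1) \sum_(j < m.+1) \sum_(k < m.+1 | (i + j + k <= m)%N)
            c i j k * y 0 0 ^+ i * y 0 1 ^+ j * y 0 2 ^+ k.

Definition is_vpoly (m : nat) (q : 'rV[R]_3 -> 'rV[R]_3) : Prop :=
  forall k : 'I_3, is_poly m (fun y => q y 0 k).

(* Integral over the segment [a, b] with respect to arc length. *)
Definition int_segment (a b : 'rV[R]_3) (g : 'rV[R]_3 -> R) : R :=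
  enorm (b - a) *
  Rintegral lebesgue_measure `[0, 1] (fun s : R => g (a + s *: (b - a))).

Definition area (a b c : 'rV[R]_3) : R := enorm (crossp (b - a) (c - a)) / 2.

(* Integral over the triangle a b c with respect to surface measure: the
   parametrization a + s (b - a) + t (c - a) over s, t >= 0, s + t <= 1 has
   constant surface element |(b - a) x (c - a)|. *)
Definition int_triangle (a b c : 'rV[R]_3) (g : 'rV[R]_3 -> R) : R :=
  enorm (crossp (b - a) (c - a)) *
  Rintegral lebesgue_measure `[0, 1] (fun s : R =>
    Rintegral lebesgue_measure `[0, 1 - s] (fun t : R =>
      g (a + s *: (b - a) + t *: (c - a)))).

End Vectors.

Section Tetrahedron.
Variables (R : realType) (x : 'I_4 -> 'rV[R]_3).

(* x_2 - x_1, x_3 - x_1, x_4 - x_1 are linearly independent. *)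
Definition tetra_nondegenerate : Prop :=
  row_free (\matrix_(i < 3) (x (lift ord0 i) - x ord0)).

Definition barycenter : 'rV[R]_3 := 4^-1 *: \sum_(i < 4) x i.

Definition is_barycentric (lam : 'I_4 -> 'rV[R]_3 -> R) : Prop :=
  forall y, \sum_(i < 4) lam i y = 1 /\ \sum_(i < 4) lam i y *: x i = y.

(* lift l enumerates the indices other than l in increasing order, so these are
   l_1 < l_2 < l_3. *)
Definition fv1 (l : 'I_4) : 'I_4 := lift l (0 : 'I_3).
Definition fv2 (l : 'I_4) : 'I_4 := lift l (1 : 'I_3).
Definition fv3 (l : 'I_4) : 'I_4 := lift l (2 : 'I_3).

Definition is_outward_normals (n : 'I_4 -> 'rV[R]_3) : Prop :=
  forall l, [/\ enorm (n l) = 1,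
    forall a b, a != l -> b != l -> dotp (x b - x a) (n l) = 0 &
    forall a, a != l -> dotp (x l - x a) (n l) < 0].

(* v belongs to grad P_1 + (y - x_K) x P_1^3. *)
Definition in_W0 (v : 'rV[R]_3 -> 'rV[R]_3) : Prop :=
  exists p q, [/\ is_poly 1 p, is_vpoly 1 q &
    forall y, v y = grad p y + crossp (y - barycenter) (q y)].

Definition face_area (l : 'I_4) : R := area (x (fv1 l)) (x (fv2 l)) (x (fv3 l)).

Definition int_face (l : 'I_4) (g : 'rV[R]_3 -> R) : R :=
  int_triangle (x (fv1 l)) (x (fv2 l)) (x (fv3 l)) g.

Definition Me (i j : 'I_4) (v : 'rV[R]_3 -> 'rV[R]_3) : R :=
  (enorm (x j - x i))^-1 *
  int_segment (x i) (x j) (fun y => dotp (v y) (x j - x i)).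

Variables (lam : 'I_4 -> 'rV[R]_3 -> R) (n : 'I_4 -> 'rV[R]_3).

Definition MF (l : 'I_4) (v : 'rV[R]_3 -> 'rV[R]_3) : 'rV[R]_3 :=
  \row_k int_face l (fun y => crossp (curl v y) (n l) 0 k).

(* Barycentric coordinates are affine functions, so their gradients are constant and may be evaluated
   at any point. *)
Definition gradlam (i : 'I_4) : 'rV[R]_3 := grad (lam i) barycenter.

Definition MFpq (l p q : 'I_4) (v : 'rV[R]_3 -> 'rV[R]_3) : R :=
  (2 * face_area l * dotp (crossp (gradlam p) (gradlam q)) (n l))^-1 *
  int_face l (fun y =>
    dotp (curl v y) (crossp (crossp (n l) (gradlam q)) (n l))).

Definition MF1 (l : 'I_4) := MFpq l (fv1 l) (fv2 l).
Definition MF2 (l : 'I_4) := MFpq l (fv2 l) (fv1 l).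

Definition phip (l p : 'I_4) (y : 'rV[R]_3) : 'rV[R]_3 :=
  (4^-1 * (8 * lam l y - 3)) *:
    crossp (y - barycenter) (crossp (n l) (gradlam p))
  + (4^-1 * dotp (x l - barycenter) (n l)) *: gradlam p
  + 16^-1 *: n l.

Definition phi1 (l : 'I_4) := phip l (fv1 l).
Definition phi2 (l : 'I_4) := phip l (fv2 l).

End Tetrahedron.

(* Main.v *)
Require Import Defs.
From mathcomp Require Import all_boot all_order all_algebra.
From mathcomp Require Import all_classical all_reals all_analysis.
From mathcomp Require Import ring lra.


(**
Write g_i for the constant gradient of lambda_i, b for the barycenter, and
w := n_l x g_p with p one of the first two vertices of F_l. Everything follows
from two closed forms of the shape function phi attached to (l, p).

First, n_l = - c g_l with c > 0 ([normal_gradlam]), so the double product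
expansion gives ([phipE])

  phi = c ((8 lambda_l - 3)/4 ((lambda_l - 1/4) g_p - (lambda_p - 1/4) g_l)
           - 3/16 g_p - 1/16 g_l).

On an edge t = x_j - x_i the numbers g_k . t are differences of Kronecker
symbols and the quadratic terms of phi . t cancel; what is left is an affine
function of the arc parameter that vanishes at the midpoint of the edge, hence
has integral zero ([Me_phip]).

Second, since g_l . w = 0, the product rule for curl gives ([curl_phip])

  curl phi = (2 - 6 lambda_l) w.

The mean value of lambda_l over a face is 1/3 when the face contains x_l and 0
on F_l itself. So the integral of curl phi is 0 over every face other than F_l
and 2 |F_l| w over F_l ([int_face_lam]). This settles the face functionals: the
pairing of w with (n_l x g_q) x n_l is the normal component of g_p x g_q, which
is the normalising denominator when q is the other index and 0 when q = p. That
the denominator is nonzero is the nondegeneracy of K: the edge vectors issued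
from a vertex and the gradients of the three opposite barycentric coordinates
are dual bases, so their triple products multiply to 1 ([triple_gradlam]).

The barycentric coordinates are only given by their defining equations, so
their values at vertices, their affinity and their gradients are all derived
from uniqueness ([barycentric_unique]).
*)

Set Implicit Arguments.
Unset Strict Implicit.
Unset Printing Implicit Defensive.

Import Order.TTheory GRing.Theory Num.Theory.
Import numFieldNormedType.Exports.

Local Open Scope classical_set_scope.
Local Open Scope ring_scope.

(** * Derivatives and integrals of polynomials of low degree *)

Section Calculus.
Variable R : realType.
Implicit Types (u v w y : 'rV[R]_3).

(** All functions differentiated here are polynomials of degree at most two along
    lines, so a derivative can be read off as a linear coefficient. *)
Lemma derive_quadratic (f : 'rV[R]_3 -> R) v y (A B : R) :
  (forall h : R, f (h *: v + y) = f y + h * A + h ^+ 2 * B) -> 'D_v f y = A.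
Proof.
move=> fE; rewrite /derive; apply: cvg_lim => //.
have cvgA : (fun h : R => A + h * B) @ 0^' --> A.
  rewrite -[X in _ --> X](_ : A + 0 * B = A); last by rewrite mul0r addr0.
  apply: cvg_within_filter; apply: cvgD; first exact: cvg_cst.
  by apply: cvgM; [exact: cvg_id|exact: cvg_cst].
apply: cvg_trans cvgA; apply: near_eq_cvg.
near=> h.
have h0 : h != 0 by near: h; exact: nbhs_dnbhs_neq.
rewrite /= fE /GRing.scale /=; field; exact: h0.
Unshelve. all: by end_near. Qed.

Lemma Rintegral_quadratic (a b c d : R) : 0 <= d ->
  \int[lebesgue_measure]_(s in `[0, d]) (a + b * s + c * s ^+ 2) =
  a * d + b / 2 * d ^+ 2 + c / 3 * d ^+ 3.
Proof.
rewrite le_eqVlt => /orP[/eqP <-|d0].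
  by rewrite set_itv1 Rintegral_set1; ring.
pose F (s : R) := a * s + b / 2 * s ^+ 2 + c / 3 * s ^+ 3.
have dF (s : R) : is_derive s 1 F (a + b * s + c * s ^+ 2).
  rewrite /F; apply: is_derive_eq.
  by rewrite /GRing.scale /=; field.
have cF : continuous F.
  move=> s; apply/differentiable_continuous/derivable1_diffP.
  by case: (dF s).
rewrite /Rintegral (@continuous_FTC2 _ _ F)//.
- by rewrite /= /F; ring.
- apply: continuous_subspaceT => s.
  apply: cvgD; last by apply: cvgM; [exact: cvg_cst|exact: exprn_continuous].
  by apply: cvgD; [exact: cvg_cst|apply: cvgM; [exact: cvg_cst|exact: cvg_id]].
- split=> [s _||]; first by case: (dF s).
  + exact/cvg_at_right_filter/cF.
  + exact/cvg_at_left_filter/cF.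
- by move=> s _; rewrite derive1E; case: (dF s).
Qed.

(** The vertex quadrature rule: an affine function integrates to the area times
    the mean of its vertex values. Affinity is only required in the form in which
    the parametrization of the triangle uses it. *)
Lemma int_triangle_affine u v w (f : 'rV[R]_3 -> R) :
  (forall s t : R, f (u + s *: (v - u) + t *: (w - u)) =
     f u + s * (f v - f u) + t * (f w - f u)) ->
  int_triangle u v w f = enorm (crossp (v - u) (w - u)) * (f u + f v + f w) / 6.
Proof.
move=> fE; rewrite /int_triangle -mulrA; congr (_ * _).
set p := f u in fE *; set q := f v in fE *; set r := f w in fE *.
transitivity (\int[@lebesgue_measure R]_(s in `[0, 1])
    ((p + r) / 2 + (q - p - r) * s + ((p + r) / 2 - q) * s ^+ 2)); last first.
  by rewrite Rintegral_quadratic//; field.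
apply: eq_Rintegral => s; rewrite inE /= in_itv /= => /andP[s0 s1].
transitivity (\int[@lebesgue_measure R]_(t in `[0, 1 - s])
    ((p + s * (q - p)) + (r - p) * t + 0 * t ^+ 2)).
  by apply: eq_Rintegral => t _; rewrite fE; ring.
by rewrite Rintegral_quadratic ?subr_ge0//; field.
Qed.

End Calculus.

(** * Dot and cross products *)

Section VectorAlgebra.
Variable R : realType.
Implicit Types (u v w a b c y : 'rV[R]_3).

Lemma vec3E (p q r : R) :
  ((vec3 p q r 0 0 = p) * (vec3 p q r 0 1 = q) * (vec3 p q r 0 2 = r))%type.
Proof. by rewrite !mxE. Qed.

Lemma dotpE u v : dotp u v = u 0 0 * v 0 0 + u 0 1 * v 0 1 + u 0 2 * v 0 2.
Proof.
by rewrite /dotp !big_ord_recl big_ord0 addr0 addrA; congr (_ * _ + _ * _ + _ * _);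
  congr (_ _ _); apply/val_inj.
Qed.

Lemma forall_ord3 (P : 'I_3 -> Prop) : P 0 -> P 1 -> P 2 -> forall k, P k.
Proof.
move=> P0 P1 P2 [[|[|[|k]]] lk] //;
  [move: P0|move: P1|move: P2]; congr P; exact/val_inj.
Qed.

Lemma eq_vec3 u v :
  u 0 0 = v 0 0 -> u 0 1 = v 0 1 -> u 0 2 = v 0 2 -> u = v.
Proof. by move=> *; apply/rowP; exact: forall_ord3. Qed.

Lemma dotpC u v : dotp u v = dotp v u.
Proof. by rewrite !dotpE; ring. Qed.

Lemma dotpZr k u v : dotp u (k *: v) = k * dotp u v.
Proof. by rewrite !dotpE !mxE; ring. Qed.

Lemma dotpZl k u v : dotp (k *: u) v = k * dotp u v.
Proof. by rewrite dotpC dotpZr dotpC. Qed.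

Lemma dotpBr u v w : dotp u (v - w) = dotp u v - dotp u w.
Proof. by rewrite !dotpE !mxE; ring. Qed.

Lemma dotp0l u : dotp 0 u = 0.
Proof. by rewrite !dotpE !mxE; ring. Qed.

Lemma crossp_crossp u v w : crossp u (crossp v w) = dotp u w *: v - dotp u v *: w.
Proof. by apply: eq_vec3; rewrite !dotpE !mxE /=; ring. Qed.

Lemma crosspZr k u v : crossp u (k *: v) = k *: crossp u v.
Proof. by apply: eq_vec3; rewrite !(vec3E, mxE) /=; ring. Qed.

Lemma crosspZl k u v : crossp (k *: u) v = k *: crossp u v.
Proof. by apply: eq_vec3; rewrite !(vec3E, mxE) /=; ring. Qed.

Lemma dotp_crossp_self u v : dotp u (crossp u v) = 0.
Proof. by rewrite dotpE !vec3E; ring. Qed.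

Lemma crosspp u : crossp u u = 0.
Proof. by apply: eq_vec3; rewrite !(vec3E, mxE) /=; ring. Qed.

(** For a unit vector u, [crossp (crossp u w) u] is the component of w orthogonal
    to u, which pairs with u x v like w itself; in general a factor |u|^2 appears. *)
Lemma dotp_crossp_tangential u v w :
  dotp (crossp u v) (crossp (crossp u w) u) = dotp (crossp v w) u * dotp u u.
Proof.
have -> : crossp (crossp u w) u = dotp u u *: w - dotp u w *: u.
  by apply: eq_vec3; rewrite !(dotpE, vec3E, mxE) /=; ring.
by rewrite dotpBr !dotpZr !dotpE !vec3E; ring.
Qed.

(** Multiplicativity of the determinant: the right-hand side is the determinant of
    the matrix of pairwise dot products. *)
Lemma triple_mul_triple a b c u v w :
  dotp (crossp a b) c * dotp (crossp u v) w =
  dotp a u * (dotp b v * dotp c w - dotp b w * dotp c v)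
  - dotp a v * (dotp b u * dotp c w - dotp b w * dotp c u)
  + dotp a w * (dotp b u * dotp c v - dotp b v * dotp c u).
Proof. by rewrite !dotpE !vec3E; ring. Qed.

Lemma enorm_eq0 u : (enorm u == 0) = (u == 0).
Proof.
apply/idP/eqP => [|->]; last by rewrite /enorm dotp0l sqrtr0.
rewrite sqrtr_eq0 dotpE => norm_le0.
have := sqr_ge0 (u 0 0); have := sqr_ge0 (u 0 1); have := sqr_ge0 (u 0 2).
rewrite !expr2 => h2 h1 h0.
by apply: eq_vec3; rewrite mxE; apply/eqP; rewrite -[_ == 0]orbb -mulf_eq0;
  apply/eqP; lra.
Qed.

Lemma affine_is_poly1 (e : R) u : is_poly 1 (fun y => e + dotp u y).
Proof.
exists (fun i j k => match i, j, k with
  | O, O, O => e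
  | S O, O, O => u 0 0 | O, S O, O => u 0 1 | O, O, S O => u 0 2
  | _, _, _ => 0 end) => y.
do 6 rewrite ?big_mkcond /= ?big_ord_recl ?big_ord0 /bump /=.
by rewrite dotpE; ring.
Qed.

End VectorAlgebra.

(** * Gradient and curl *)

Section Curl.
Variable R : realType.
Implicit Types (g b w k y : 'rV[R]_3).

Lemma grad_affine (f : 'rV[R]_3 -> R) g :
  (forall y z, f y = f z + dotp g (y - z)) -> forall y, grad f y = g.
Proof.
move=> fE y; apply/rowP => k; rewrite mxE; apply: (@derive_quadratic _ _ _ _ _ 0) => h.
rewrite (fE _ y) addrK mulr0 addr0; congr (_ + _); rewrite dotpE !mxE.
by elim/forall_ord3: k => /=; ring.
Qed.

(** The product rule curl (a v) = grad a x v + a curl v, for the rotation field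
    v(z) = (z - b) x w, whose curl is - 2 w. *)
Lemma curl_scale_crossp (a : 'rV[R]_3 -> R) g b w k y :
  (forall y z, a y = a z + dotp g (y - z)) ->
  curl (fun z => a z *: crossp (z - b) w + k) y =
  crossp g (crossp (y - b) w) - (2 * a y) *: w.
Proof.
move=> aE.
(* The quadratic term along a coordinate line comes from the two linear factors. *)
have dE (i j : 'I_3) :
    partial i (fun z => (a z *: crossp (z - b) w + k) 0 j) y =
    g 0 i * crossp (y - b) w 0 j + a y * crossp (delta_mx 0 i) w 0 j.
  apply: (@derive_quadratic _ _ _ _ _ (g 0 i * crossp (delta_mx 0 i) w 0 j)) => h.
  have -> : a (h *: delta_mx 0 i + y) = a y + h * g 0 i.
    rewrite (aE _ y) addrK dotpE !mxE.
    by elim/forall_ord3: i => /=; ring.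
  have -> : crossp (h *: delta_mx 0 i + y - b) w =
            crossp (y - b) w + h *: crossp (delta_mx 0 i) w.
    by apply: eq_vec3; rewrite !(vec3E, mxE) /=; ring.
  by rewrite !mxE; ring.
by rewrite /curl; apply: eq_vec3; rewrite vec3E !dE !(vec3E, mxE) /=; ring.
Qed.

End Curl.

(** * Barycentric coordinates and the shape functions *)

Section Barycentric.
Variables (R : realType) (x : 'I_4 -> 'rV[R]_3).
Hypothesis hx : tetra_nondegenerate x.

(** When the weights sum to zero, the weighted sum of the vertices only depends on
    the edge vectors issued from the vertex of index 0. *)
Lemma sum_mul_edges (c : 'I_4 -> R) :
  \sum_i c i = 0 ->
  (\row_(i < 3) c (lift ord0 i)) *m \matrix_(i < 3) (x (lift ord0 i) - x ord0) =
  \sum_i c i *: x i.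
Proof.
move=> c0; apply/rowP => k; rewrite mxE summxE [in RHS]big_ord_recl.
have -> : c ord0 = - \sum_(i < 3) c (lift ord0 i).
  by move: c0; rewrite big_ord_recl => /eqP; rewrite addr_eq0 => /eqP.
rewrite !mxE mulNr mulr_suml -sumrN -big_split /=.
by apply: eq_bigr => i _; rewrite !mxE; ring.
Qed.

(** Two families of weights with equal sums and equal weighted sums of vertices
    differ by an affine dependence between the vertices, and there is none. *)
Lemma barycentric_unique (c d : 'I_4 -> R) :
  \sum_i c i = \sum_i d i -> \sum_i c i *: x i = \sum_i d i *: x i -> c =1 d.
Proof.
move=> cd cdx.
pose e i := c i - d i.
have e0 : \sum_i e i = 0 by rewrite sumrB cd subrr.
have ex0 : \sum_i e i *: x i = 0.
  by under eq_bigr do rewrite scalerBl; rewrite sumrB cdx subrr.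
have eS i : e (lift ord0 i) = 0.
  have /rowP/(_ i) : (\row_(i < 3) e (lift ord0 i)) = 0.
    by apply: (row_free_inj hx); rewrite mul0mx sum_mul_edges.
  by rewrite !mxE.
move=> i; apply/eqP; rewrite -subr_eq0; apply/eqP; rewrite -/(e i).
case: (unliftP ord0 i) => [j ->|->]; first exact: eS.
by move: e0; rewrite big_ord_recl big1 ?addr0 // => j _; exact: eS.
Qed.

Lemma eq_of_dotp_edges (u v : 'rV[R]_3) :
  (forall i j, dotp u (x i - x j) = dotp v (x i - x j)) -> u = v.
Proof.
move=> uv; apply: trmx_inj; have := hx.
rewrite /tetra_nondegenerate row_free_unit => /mulKmx /can_inj; apply.
apply/matrixP => i k; rewrite ord1 !mxE.
transitivity (dotp u (x (lift ord0 i) - x ord0)).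
  by apply: eq_bigr => j _; rewrite !mxE; ring.
by rewrite uv; apply: eq_bigr => j _; rewrite !mxE; ring.
Qed.

Variable lam : 'I_4 -> 'rV[R]_3 -> R.
Hypothesis hlam : is_barycentric x lam.

Local Notation g := (gradlam x lam).

Lemma lam_vertex i j : lam i (x j) = (i == j)%:R.
Proof.
have [s1 sx] := hlam (x j).
apply: (@barycentric_unique (lam^~ (x j)) (fun i => (i == j)%:R)).
  by rewrite s1 (bigD1 j)//= eqxx big1 ?addr0 // => k /negbTE ->.
rewrite sx (bigD1 j)//= eqxx scale1r big1 ?addr0 // => k /negbTE ->.
by rewrite scale0r.
Qed.

Lemma lam_barycenter i : lam i (barycenter x) = 4^-1.
Proof.
have [s1 sx] := hlam (barycenter x).
apply: (@barycentric_unique (lam^~ (barycenter x)) (fun=> 4^-1)).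
  by rewrite s1 sumr_const card_ord -mulr_natr; field.
by rewrite sx /barycenter scaler_sumr.
Qed.

Lemma lam_combination i (c d : R) y z w :
  lam i (y + c *: (z - y) + d *: (w - y)) =
  lam i y + c * (lam i z - lam i y) + d * (lam i w - lam i y).
Proof.
set p := y + _ + _.
apply: (@barycentric_unique (lam^~ p) (fun i => lam i y + c * (lam i z - lam i y)
     + d * (lam i w - lam i y))).
  rewrite (hlam p).1 !big_split /= -!mulr_sumr !sumrB.
  by rewrite (hlam y).1 (hlam z).1 (hlam w).1; ring.
rewrite (hlam p).2 /p.
under eq_bigr do rewrite !scalerDl -!scalerA !scalerBl.
rewrite !big_split /= -!scaler_sumr !sumrB.
by rewrite (hlam y).2 (hlam z).2 (hlam w).2.
Qed.

(** The affine functions that agree with lambda_i at the origin and at the standard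
    basis vectors satisfy the defining equations of barycentric coordinates, hence
    are the lambda_i; their slope is then the gradient. *)
Lemma lam_affine i y z : lam i y = lam i z + dotp (g i) (y - z).
Proof.
pose G i := \row_k (lam i (delta_mx 0 k) - lam i 0).
have lamE j w : lam j w = lam j 0 + dotp (G j) w.
  apply: (@barycentric_unique (lam^~ w) (fun j => lam j 0 + dotp (G j) w)).
    rewrite (hlam w).1 big_split /= (hlam 0).1 exchange_big big1 ?addr0 //= => k _.
    under eq_bigr do rewrite mxE; rewrite -mulr_suml sumrB.
    by rewrite (hlam _).1 (hlam 0).1 subrr mul0r.
  rewrite (hlam w).2; under eq_bigr do rewrite scalerDl.
  rewrite big_split /= (hlam 0).2 add0r {1}(row_sum_delta w).
  under [RHS]eq_bigr do rewrite /dotp scaler_suml.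
  rewrite exchange_big /=; apply: eq_bigr => k _.
  under eq_bigr do rewrite mxE mulrC -scalerA scalerBl.
  by rewrite -scaler_sumr sumrB (hlam _).2 (hlam 0).2 subr0.
have GE a b : lam i a = lam i b + dotp (G i) (a - b).
  by rewrite [LHS]lamE [lam i b]lamE dotpBr; ring.
by rewrite /gradlam (grad_affine GE).
Qed.

Lemma gradlam_edge i j k :
  dotp (g i) (x j - x k) = (i == j)%:R - (i == k)%:R.
Proof. by rewrite -!lam_vertex [lam i (x j)](lam_affine i _ (x k)); ring. Qed.

(** The gradients g_p, g_q, g_l and the edge vectors issued from x_r are dual
    bases. *)
Lemma triple_gradlam p q r l : uniq [:: p; q; r; l] ->
  dotp (crossp (g p) (g q)) (g l) *
  dotp (crossp (x p - x r) (x q - x r)) (x l - x r) = 1.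
Proof.
rewrite /= !inE !negb_or => /and4P[/and3P[pq pr pl] /andP[qr ql] rl _].
rewrite triple_mul_triple !gradlam_edge !eqxx.
rewrite [l == p]eq_sym [l == q]eq_sym [l == r]eq_sym [q == p]eq_sym.
rewrite (negbTE pq) (negbTE pr) (negbTE pl) (negbTE qr) (negbTE ql) (negbTE rl).
by rewrite /=; ring.
Qed.

Lemma uniq_face l : uniq [:: fv1 l; fv2 l; fv3 l; l].
Proof.
by case: l => [[|[|[|[|l]]]] hl].
Qed.

Lemma face_area_neq0 l : face_area x l != 0.
Proof.
rewrite /face_area /area mulf_eq0 enorm_eq0 invr_eq0 pnatr_eq0 orbF.
apply/eqP => cross0.
have : uniq [:: fv2 l; fv3 l; fv1 l; l].
  have := uniq_face l; rewrite (perm_uniq (s2 := [:: fv2 l; fv3 l; fv1 l; l])) //.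
  by rewrite (perm_catCA [:: fv1 l] [:: fv2 l; fv3 l] [:: l]).
move=> /triple_gradlam /eqP.
by rewrite cross0 dotp0l mulr0 eq_sym oner_eq0.
Qed.

Lemma sum_lam_face l m :
  lam l (x (fv1 m)) + lam l (x (fv2 m)) + lam l (x (fv3 m)) = (l != m)%:R.
Proof.
rewrite !lam_vertex.
by case: l m => [[|[|[|[|l]]]] hl] [[|[|[|[|m]]]] hm] //=; rewrite /= ?(addr0, add0r).
Qed.

(** The mean of lambda_l over F_m is 1/3 if x_l is one of its vertices, and 0 if
    m = l; the factor 2 - 6 lambda_l is the one that occurs in the curl of the
    shape functions. *)
Lemma int_face_lam l m (k : R) :
  int_face x m (fun y => (2 - 6 * lam l y) * k) = (l == m)%:R * (2 * face_area x m * k).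
Proof.
rewrite /int_face int_triangle_affine; last by move=> s t; rewrite lam_combination; ring.
rewrite /face_area /area; set A := enorm _.
have := sum_lam_face l m; case: eqP => _ /= s;
  rewrite -[lam l (x (fv1 m))](addrK (lam l (x (fv2 m)) + lam l (x (fv3 m)))) addrA s;
  by field.
Qed.

Variable n : 'I_4 -> 'rV[R]_3.
Hypothesis hn : is_outward_normals x n.

(** Both n_l and g_l are orthogonal to F_l, and lambda_l decreases outwards through
    F_l. *)
Lemma normal_gradlam l : exists2 c, 0 < c & n l = - c *: g l.
Proof.
have [_ nface nin] := hn l.
pose a := fv1 l; have al : a != l by rewrite eq_sym neq_lift.
pose c := - dotp (x l - x a) (n l).
exists c; first by rewrite oppr_gt0 nin.
have nE i : dotp (x i - x a) (n l) = - c * (i == l)%:R.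
  have [->|il] := eqVneq i l; first by rewrite mulr1 opprK.
  by rewrite nface // mulr0.
apply: eq_of_dotp_edges => i j; rewrite dotpZl gradlam_edge.
have -> : x i - x j = (x i - x a) - (x j - x a) by rewrite opprB addrA subrK.
by rewrite dotpBr ![dotp (n l) _]dotpC !nE ![l == _]eq_sym; ring.
Qed.

Section Phi.
Variables (l p : 'I_4).
Hypothesis pl : p != l.
Local Notation phi := (phip x lam n l p).

(** The constant part of phi is the gradient of a linear function, and its
    remaining part is (y - b) x q with q an affine multiple of w. *)
Lemma phip_in_W0 : in_W0 x phi.
Proof.
pose u := (4^-1 * dotp (x l - barycenter x) (n l)) *: g p + 16^-1 *: n l.
pose w := crossp (n l) (g p).
exists (fun y => 0 + dotp u y), (fun y => (4^-1 * (8 * lam l y - 3)) *: w).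
split; first exact: affine_is_poly1.
- move=> k.
  have -> : (fun y => ((4^-1 * (8 * lam l y - 3)) *: w) 0 k) =
     (fun y => (4^-1 * (8 * lam l 0 - 3) * w 0 k) + dotp ((2 * w 0 k) *: g l) y).
    apply/funext => y; rewrite (lam_affine l y 0) subr0 dotpZl !mxE.
    by field.
  exact: affine_is_poly1.
- move=> y; rewrite (@grad_affine _ _ u); last by move=> a b; rewrite dotpBr; ring.
  by rewrite /phip -/w /u -addrA addrC crosspZr.
Qed.

(** The factor -3/16 of g_p arises from (x_l - b) . n_l = - c (1 - 1/4). *)
Lemma phipE (c : R) y : n l = - c *: g l -> 
  phi y = c *: ((4^-1 * (8 * lam l y - 3)) *:
      ((lam l y - 4^-1) *: g p - (lam p y - 4^-1) *: g l)
    - (3 / 16) *: g p - 16^-1 *: g l).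
Proof.
move=> nE.
have zE i w : dotp (w - barycenter x) (g i) = lam i w - 4^-1.
  by rewrite dotpC (lam_affine i w (barycenter x)) lam_barycenter; ring.
rewrite /phip crossp_crossp nE !dotpZr !zE lam_vertex eqxx.
move: (g p) (g l) (lam l y) (lam p y) => u v a b.
by apply/rowP => k; rewrite !mxE /=; field.
Qed.

(** The tangential component of phi along an edge is affine and vanishes at the
    midpoint. Its coefficients depend on which endpoints of the edge are x_l and
    x_p, and the verification runs over these incidences. *)
Lemma Me_phip i j : i != j -> Me x i j phi = 0.
Proof.
move=> ij; have [c _ nE] := normal_gradlam l.
rewrite /Me /int_segment mulrA.
set t := x j - x i.
pose li := (l == i)%:R : R; pose lj := (l == j)%:R : R.
pose pi := (p == i)%:R : R; pose pj := (p == j)%:R : R.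
(* With s the edge parameter, lambda_k is (k == i) + s ((k == j) - (k == i)), of
   slope d_k = g_k . t, so s ^ 2 has coefficient 2 c d_l (d_l d_p - d_p d_l) = 0. *)
transitivity ((enorm t)^-1 * enorm t * \int[@lebesgue_measure R]_(s in `[0, 1])
   (c * ((2 * li - 3/4) * ((li - 4^-1) * (pj - pi) - (pi - 4^-1) * (lj - li))
     - (3 / 16) * (pj - pi) - 16^-1 * (lj - li))
   + c * (2 * (lj - li) * ((li - 4^-1) * (pj - pi) - (pi - 4^-1) * (lj - li))) * s
   + 0 * s ^+ 2)).
  congr (_ * _); apply: eq_Rintegral => s _.
  rewrite (phipE _ nE) dotpC !(dotpZr, dotpBr) ![dotp t _]dotpC !gradlam_edge.
  have lamE k : lam k (x i + s *: t) = (k == i)%:R + s * ((k == j)%:R - (k == i)%:R).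
    by rewrite (lam_affine k _ (x i)) (addrC (x i)) addrK dotpZr gradlam_edge lam_vertex.
  by rewrite !lamE -/li -/lj -/pi -/pj; field.
rewrite Rintegral_quadratic // /li /lj /pi /pj.
(* Incidences that would identify x_i with x_j, or x_l with x_p, are excluded. *)
have excl (a b k : 'I_4) : a != b -> ~~ ((a == k) && (b == k)).
  by apply: contra => /andP[/eqP -> /eqP ->].
have := excl _ _ i pl; have := excl _ _ j pl.
have := excl _ _ l ij; have := excl _ _ p ij; rewrite ![i == _]eq_sym ![j == _]eq_sym.
move: (_ * enorm t) => C.
by case: (l == i); case: (l == j); case: (p == i); case: (p == j) => //= _ _ _ _; field.
Qed.

(** The product rule gives - 2 (lambda_l - 1/4) w from the gradient of the scalar
    factor and - (4 lambda_l - 3/2) w from the rotation field. *)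
Lemma curl_phip y : curl phi y = (2 - 6 * lam l y) *: crossp (n l) (g p).
Proof.
have [c _ nE] := normal_gradlam l.
set w := crossp (n l) (g p).
have -> : phi = fun z => (4^-1 * (8 * lam l z - 3)) *: crossp (z - barycenter x) w
    + ((4^-1 * dotp (x l - barycenter x) (n l)) *: g p + 16^-1 *: n l).
  by apply/funext => z; rewrite addrA.
rewrite (@curl_scale_crossp _ _ (2 *: g l)); last first.
  move=> a b; rewrite (lam_affine l a b) dotpZl.
  by field.
have gw : dotp (2 *: g l) w = 0.
  by rewrite /w nE crosspZl dotpZr dotpZl dotp_crossp_self !mulr0.
have gz : dotp (2 *: g l) (y - barycenter x) = 2 * (lam l y - 4^-1).
  by rewrite (lam_affine l y (barycenter x)) lam_barycenter dotpZl; ring.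
rewrite crossp_crossp gw gz scale0r sub0r -scaleNr -scalerBl; congr (_ *: _).
by field.
Qed.

Lemma MF_phip m : m != l -> MF x n m phi = 0.
Proof.
move=> ml; apply/rowP => k; rewrite !mxE.
have -> : (fun y => crossp (curl phi y) (n m) 0 k) =
    fun y => (2 - 6 * lam l y) * crossp (crossp (n l) (g p)) (n m) 0 k.
  by apply/funext => y; rewrite curl_phip crosspZl [LHS]mxE.
by rewrite int_face_lam eq_sym (negbTE ml) mul0r.
Qed.

Lemma int_face_curl_phip u :
  int_face x l (fun y => dotp (curl phi y) u) =
  2 * face_area x l * dotp (crossp (n l) (g p)) u.
Proof.
have := int_face_lam l l (dotp (crossp (n l) (g p)) u); rewrite eqxx mul1r => <-.
congr int_face; apply/funext => y.
by rewrite curl_phip dotpZl.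
Qed.

Lemma MFpq_phip_other q : MFpq x lam n l q p phi = 0.
Proof.
rewrite /MFpq int_face_curl_phip.
by rewrite dotp_crossp_tangential crosspp dotp0l mul0r !mulr0.
Qed.

Lemma MFpq_phip_self q r : uniq [:: p; q; r; l] -> MFpq x lam n l p q phi = 1.
Proof.
move=> pqrl; rewrite /MFpq int_face_curl_phip.
have [n1 _ _] := hn l; have [c c0 nE] := normal_gradlam l.
set D := dotp (crossp (g p) (g q)) (n l).
rewrite dotp_crossp_tangential -/D.
have nn : dotp (n l) (n l) = 1.
  have n0 : 0 <= dotp (n l) (n l) by rewrite dotpE !addr_ge0 // -expr2 sqr_ge0.
  by rewrite -(sqr_sqrtr n0) -/(enorm _) n1 expr1n.
have D0 : D != 0.
  rewrite /D nE dotpZr mulf_neq0 ?oppr_eq0 ?(lt0r_neq0 c0) //.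
  by apply/eqP => D0; have /eqP := triple_gradlam pqrl; rewrite D0 mul0r eq_sym oner_eq0.
rewrite nn mulr1 mulVf //; apply: mulf_neq0 D0.
by apply: mulf_neq0 (face_area_neq0 l); rewrite pnatr_eq0.
Qed.

End Phi.
End Barycentric.

(** * Duality *)

Theorem lemma2p4 (R : realType) (x : 'I_4 -> 'rV[R]_3)
  (hx : tetra_nondegenerate x)
  (lam : 'I_4 -> 'rV[R]_3 -> R) (hlam : is_barycentric x lam)
  (n : 'I_4 -> 'rV[R]_3) (hn : is_outward_normals x n)
  (l : 'I_4) :
  let phi_1 := phi1 x lam n l in
  let phi_2 := phi2 x lam n l in
  (in_W0 x phi_1 /\ in_W0 x phi_2) /\
  (forall i j : 'I_4, i != j ->
     Me x i j phi_1 = 0 /\ Me x i j phi_2 = 0) /\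
  (forall m : 'I_4, m != l ->
     MF x n m phi_1 = 0 /\ MF x n m phi_2 = 0) /\
  (MF2 x lam n l phi_1 = 0 /\ MF1 x lam n l phi_2 = 0) /\
  (MF1 x lam n l phi_1 = 1 /\ MF2 x lam n l phi_2 = 1).
Proof.
move=> phi_1 phi_2.
have p1l : fv1 l != l by rewrite eq_sym neq_lift.
have p2l : fv2 l != l by rewrite eq_sym neq_lift.
split; [|split; [|split; [|split]]].
- by split; exact: phip_in_W0.
- by move=> i j ij; split; exact: Me_phip.
- by move=> m ml; split; exact: MF_phip.
- by split; exact: MFpq_phip_other.
- split; first exact: MFpq_phip_self (uniq_face l).
  apply: (@MFpq_phip_self _ _ hx _ hlam _ hn _ _ _ (fv3 l)).
  have := uniq_face l; rewrite (perm_uniq (s2 := [:: fv2 l; fv1 l; fv3 l; l])) //.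
  by rewrite (perm_catCA [:: fv1 l] [:: fv2 l] [:: fv3 l; l]).
Qed.
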